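(* Let $G$ be a finite group. The maps $\to_{\bullet}:\mathrm{Ind}(G)\rightleftarrows\mathrm{Tr}(G):\mathcal{I}_{\bullet}$, sending a $G$-indexing system $\mathcal{I}$ to its graph $\to_{\mathcal{I}}$ and a $G$-transfer system $\to$ to $\mathcal{I}_{\to}$, are inverse order isomorphisms, and they restrict to an isomorphism between the subposet of $\Lambda$-indexing systems and the subposet of saturated transfer systems.
   Context: Let $G$ be a finite group and $\mathrm{Sub}(G)$ its set of subgroups. A $G$-indexing system $\mathcal{I}$ assigns to each subgroup $H\subset G$ a class $\mathcal{I}(H)$ of finite $H$-sets such that: (1) $\mathcal{I}(H)$ contains all finite trivial $H$-sets; (2) $\mathcal{I}(H)$ is closed under isomorphism; (3) if $K\subset H$ and $T\in\mathcal{I}(H)$ then $\mathrm{res}^H_K T\in\mathcal{I}(K)$; (4) if $g\in G$ and $T\in\mathcal{I}(H)$ then the conjugate $gHg^{-1}$-set $c_gT$ lies in $\mathcal{I}(gHg^{-1})$; (5) $\mathcal{I}(H)$ is closed under passage to sub-$H$-sets; (6) $\mathcal{I}(H)$ is closed under binary coproducts; (7) if $K\subset H$, $T\in\mathcal{I}(K)$ and $H/K\in\mathcal{I}(H)$, then $\mathrm{ind}_K^H T\in\mathcal{I}(H)$. $\mathrm{Ind}(G)$ is the poset of all $G$-indexing systems under inclusion. A $\Lambda$-indexing system is an indexing system such that for all $K\subset L\subset H\subset G$, if $H/K\in\mathcal{I}(H)$ then $L/K\in\mathcal{I}(L)$ and $H/L\in\mathcal{I}(H)$. A $G$-transfer system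 is a partial order $\to$ on $\mathrm{Sub}(G)$ such that: if $K\to H$ then $K\subset H$; if $K\to H$ then $gKg^{-1}\to gHg^{-1}$ for all $g\in G$; if $K\to H$ and $L\subset H$ then $K\cap L\to L$. It is saturated if $K\to H$ and $K\subset L\subset H$ imply $K\to L$ and $L\to H$. $\mathrm{Tr}(G)$ is the poset of all $G$-transfer systems under refinement: $\to_1\ \le\ \to_2$ iff $K\to_1H$ implies $K\to_2H$ for all $K,H\subset G$. The graph of an indexing system $\mathcal{I}$ is the relation: $K\to_{\mathcal{I}}H$ iff $K\subset H$ and $H/K\in\mathcal{I}(H)$. For a transfer system $\to$, $\mathcal{I}_{\to}(H)$ is the class of all finite $H$-sets $T$ such that $T\cong\coprod_{i=1}^nH/K_i$ for some $n\ge0$ and $K_1,\dots,K_n\subset H$ with $K_i\to H$ for all $i$ (empty coproducts are $\varnothing$). *)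

(* Defs.v *)
From mathcomp Require Import all_boot all_fingroup.

Set Implicit Arguments.
Unset Strict Implicit.
Unset Printing Implicit Defensive.

Local Open Scope group_scope.

(* Throughout, the finite group is the whole type gT, so that Sub(G) is       *)
(* {group gT}.                                                                *)
(*   MathComp actions are right actions.  A left H-set is the right H-set     *)
(* with x . h := h^-1 x; under this dictionary the left H-set H/K (h acting   *)
(* on aK) becomes, via aK |-> K a^-1, the set rcosets K H of right cosets     *)
(* with H acting by right translation, and the induced set H x_K T becomes    *)
(* the balanced product T x_K H.  The action is only meaningful on H: its     *)
(* values outside H are ignored by every notion below.                        *)
Record hset (gT : finGroupType) (H : {group gT}) : Type := HSet {
  hset_sort :> finType;
  hset_act : action H hset_sort
}.

Section HSets.
Variable gT : finGroupType.
Implicit Types (H K L : {group gT}) (g : gT).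

Definition hset_iso H (X Y : hset H) : Prop :=
  exists2 f : X -> Y, bijective f &
    forall x, {in H, forall h, f (hset_act X x h) = hset_act Y (f x) h}.

Definition hset_trivial H (X : hset H) : Prop :=
  forall x, {in H, forall h, hset_act X x h = x}.

Definition hset_res H K (sKH : K \subset H) (X : hset H) : hset K :=
  HSet (hset_act X \ sKH).

(* g H g^-1 is H :^ g^-1, and a in g H g^-1 acts as a ^ g = g^-1 a g in H. *)
Definition conj_act H (X : hset H) g : X -> gT -> X :=
  fun x a => hset_act X x (a ^ g).

Lemma conj_act_is_action H (X : hset H) g :
  is_action (H :^ g^-1) (@conj_act H X g).
Proof.
split=> [a x y /act_inj // | x a b]; rewrite !mem_conjgV => Ha Hb.
by rewrite /conj_act conjMg actMin.
Qed.

Definition hset_conj H g (X : hset H) : hset (H :^ g^-1)%G :=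
  @HSet gT (H :^ g^-1)%G X (Action (@conj_act_is_action H X g)).

Lemma sub_act_dom H (X : hset H) (S : {set X}) :
    [acts H, on S | hset_act X] ->
  H \subset subact_dom (fun x => x \in S) (hset_act X).
Proof.
rewrite /subact_dom; suff -> : [set x | x \in S] = S by [].
by apply/setP=> x; rewrite inE.
Qed.

Definition hset_sub H (X : hset H) (S : {set X})
    (nS : [acts H, on S | hset_act X]) : hset H :=
  @HSet gT H {x : X | x \in S}
    (subaction [the subFinType _ of {x : X | x \in S}] (hset_act X)
       \ sub_act_dom nS).

Definition sum_act H (X Y : hset H) : X + Y -> gT -> X + Y :=
  fun u h => match u with
             | inl x => inl (hset_act X x h)
             | inr y => inr (hset_act Y y h)
             end.

Lemma sum_act_is_action H (X Y : hset H) : is_action H (@sum_act H X Y).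
Proof.
split=> [h [x|y] [x'|y'] //= [] /act_inj -> // | [x|y] a b Ha Hb] /=;
by rewrite actMin.
Qed.

Definition hset_sum H (X Y : hset H) : hset H :=
  HSet (Action (@sum_act_is_action H X Y)).

Definition coprod_act H n (F : 'I_n -> hset H) :
    {i : 'I_n & F i} -> gT -> {i : 'I_n & F i} :=
  fun u h => Tagged (fun i => F i) (hset_act (F (tag u)) (tagged u) h).

Lemma coprod_act_is_action H n (F : 'I_n -> hset H) :
  is_action H (@coprod_act H n F).
Proof.
split=> [h [i x] [j y] | [i x] a b Ha Hb]; rewrite /coprod_act /=; last first.
  by rewrite actMin.
move=> /eqP; rewrite -tag_eqE /tag_eq /= => /andP[/eqP ij].
by case: j / ij y => y; rewrite tagged_asE => /eqP/act_inj->.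
Qed.

Definition hset_coprod H n (F : 'I_n -> hset H) : hset H :=
  HSet (Action (@coprod_act_is_action H n F)).

Definition Rs_hset H : hset H := @HSet gT H {set gT} ('Rs \ subsetT H).

Lemma acts_rcosets H K : [acts H, on rcosets K H | hset_act (Rs_hset H)].
Proof. by rewrite acts_ract subxx actsRs_rcosets. Qed.

Definition hset_coset H K : hset H :=
  @hset_sub H (Rs_hset H) (rcosets K H) (acts_rcosets H K).

(* The balanced product T x_K H is the set of K-orbits of X * H under         *)
(* k |-> (x k, k^-1 a), realised inside {set X * gT}.                         *)
Definition bal_act K (X : hset K) : X * gT -> gT -> X * gT :=
  fun u h => (u.1, u.2 * h).

Lemma bal_act_is_action H K (X : hset K) : is_action H (@bal_act K X).
Proof.
split=> [h [x a] [y b] [-> /mulIg ->] // | [x a] h h' _ _].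
by rewrite /bal_act /= mulgA.
Qed.

Definition bal_hset H K (X : hset K) : hset H :=
  @HSet gT H {set X * gT} (Action (@bal_act_is_action H K X))^*.

Definition bal_class K (X : hset K) (x : X) (a : gT) : {set X * gT} :=
  [set (hset_act X x k, k^-1 * a) | k in K].

Definition bal_classes H K (X : hset K) : {set {set X * gT}} :=
  [set bal_class x a | x in [set: X], a in H].

Lemma acts_bal_classes H K (X : hset K) :
  [acts H, on bal_classes H X | hset_act (bal_hset H X)].
Proof.
apply/subsetP=> h Hh; rewrite !inE Hh /=; apply/subsetP=> _ /imset2P[x a _ Ha ->].
rewrite inE; apply/imset2P; exists x (a * h); rewrite ?inE ?groupM //=.
rewrite /setact /bal_class -imset_comp; apply: eq_imset => k /=.
by rewrite /bal_act /= mulgA.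
Qed.

Definition hset_ind H K (X : hset K) : hset H :=
  @hset_sub H (bal_hset H X) (bal_classes H X) (@acts_bal_classes H K X).

End HSets.

Section Systems.
Variable gT : finGroupType.

Definition hset_family : Type := forall H : {group gT}, hset H -> Prop.
Definition sub_relation : Type := {group gT} -> {group gT} -> Prop.

Implicit Types (I J : hset_family) (R : sub_relation).

Record indexing_system I : Prop := IndexingSystem {
  idx_trivial : forall (H : {group gT}) (X : hset H), hset_trivial X -> I H X;
  idx_iso : forall (H : {group gT}) (X Y : hset H),
    hset_iso X Y -> I H X -> I H Y;
  idx_res : forall (H K : {group gT}) (sKH : K \subset H) (X : hset H),
    I H X -> I K (hset_res sKH X);
  idx_conj : forall (H : {group gT}) (g : gT) (X : hset H),
    I H X -> I (H :^ g^-1)%G (hset_conj g X);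
  idx_sub : forall (H : {group gT}) (X : hset H) (S : {set X})
      (nS : [acts H, on S | hset_act X]),
    I H X -> I H (hset_sub nS);
  idx_sum : forall (H : {group gT}) (X Y : hset H),
    I H X -> I H Y -> I H (hset_sum X Y);
  idx_ind : forall (H K : {group gT}) (X : hset K),
    K \subset H -> I K X -> I H (hset_coset H K) -> I H (hset_ind H X)
}.

Definition Lambda_indexing_system I : Prop :=
  indexing_system I /\
  forall K L H : {group gT}, K \subset L -> L \subset H ->
    I H (hset_coset H K) -> I L (hset_coset L K) /\ I H (hset_coset H L).

Record transfer_system R : Prop := TransferSystem {
  tr_refl : forall H, R H H;
  tr_anti : forall K H, R K H -> R H K -> K = H;
  tr_trans : forall L K H, R L K -> R K H -> R L H;
  tr_sub : forall K H, R K H -> K \subset H;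
  tr_conj : forall K H (g : gT), R K H -> R (K :^ g^-1)%G (H :^ g^-1)%G;
  tr_res : forall K H L : {group gT},
    R K H -> L \subset H -> R (K :&: L)%G L
}.

Definition saturated_transfer_system R : Prop :=
  transfer_system R /\
  forall K L H : {group gT}, R K H -> K \subset L -> L \subset H ->
    R K L /\ R L H.

Definition indexing_le I J : Prop :=
  forall (H : {group gT}) (X : hset H), I H X -> J H X.

Definition transfer_le R1 R2 : Prop :=
  forall K H : {group gT}, R1 K H -> R2 K H.

Definition graph I : sub_relation :=
  fun K H => K \subset H /\ I H (hset_coset H K).

Definition indexing_of R : hset_family :=
  fun H X => exists (n : nat) (K : 'I_n -> {group gT}),
    (forall i, K i \subset H /\ R (K i) H) /\
    hset_iso X (hset_coprod (fun i => hset_coset H (K i))).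

End Systems.

(* f and g restrict to mutually inverse order isomorphisms between the        *)
(* subposets cut out by PA and PB.                                            *)
Record inverse_order_isos (A B : Type) (PA : A -> Prop) (leA : A -> A -> Prop)
    (PB : B -> Prop) (leB : B -> B -> Prop) (f : A -> B) (g : B -> A) : Prop :=
  InverseOrderIsos {
    iso_fun : forall a, PA a -> PB (f a);
    iso_inv : forall b, PB b -> PA (g b);
    iso_funK : forall a, PA a -> g (f a) = a;
    iso_invK : forall b, PB b -> f (g b) = b;
    iso_fun_le : forall a a', PA a -> PA a' -> leA a a' -> leB (f a) (f a');
    iso_inv_le : forall b b', PB b -> PB b' -> leB b b' -> leA (g b) (g b')
  }.

(* Main.v *)
Require Import Defs.
From mathcomp Require Import all_boot all_fingroup.
From Stdlib Require Import FunctionalExtensionality PropExtensionality.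

(** A finite H-set is determined up to isomorphism by the stabilizers of one
    point per orbit, as the orbit of [x] is H/Stab(x).  Hence [indexing_of R], which is phrased by
    decompositions into orbits, is the class of those H-sets all of whose
    stabilizers K satisfy [R K H] ([indexing_ofP]); here closure of R under
    conjugation matters, since the points of H/K have all the conjugates of K
    as stabilizers.  In this form each operation on H-sets only has to be
    understood through its effect on stabilizers:

    - restriction to K intersects them with K, and conjugation conjugates them;
    - sub-H-sets and coproducts create no new ones;
    - induction from K to H replaces them by H-conjugates.

    Closure of [indexing_of R] under these operations is then restriction,
    conjugation and transitivity for R ([indexing_of_system]).

    Conversely, an indexing system I contains H/Stab(x) for every point x of
    every member, as I is closed under sub-H-sets ([graph_hset_stab]).  Closure
    of the graph of I under restriction, conjugation and composition follows by
    finding the wanted subgroup as a stabilizer in the restriction of H/K, in a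
    conjugate of it, or in a set induced from K/L ([graph_transfer]).

    The two constructions are mutually inverse: the members of I are the H-sets
    whose stabilizers are all in the graph ([indexing_system_stabP]), since I
    is closed under coproducts; and H/K has K itself as a stabilizer
    ([indexing_of_cosetP]).  The Lambda condition is saturation of the graph read
    through this last equivalence. *)

Set Implicit Arguments.
Unset Strict Implicit.
Unset Printing Implicit Defensive.

Local Open Scope group_scope.

Section Stabilizers.
Variable gT : finGroupType.
Implicit Types (H K L : {group gT}) (g h : gT).

(** * Isomorphisms and stabilizers of H-sets *)

Lemma group_ext K L : K =i L -> K = L.
Proof. by move=> eqKL; apply/val_inj/setP. Qed.

Definition hset_stab H (X : hset H) (x : X) : {group gT} :=
  'C_H[x | hset_act X]%G.

Lemma mem_hset_stab H (X : hset H) (x : X) h :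
  (h \in hset_stab x) = (h \in H) && (hset_act X x h == x).
Proof.
rewrite /hset_stab !inE; case: (h \in H) => //=.
by rewrite sub1set inE.
Qed.

Lemma hset_stab_sub H (X : hset H) (x : X) : hset_stab x \subset H.
Proof. exact: subsetIl. Qed.

Lemma hset_iso_surj H (X Y : hset H) (f : X -> Y) :
    injective f -> (forall y, exists x, f x = y) ->
    (forall x, {in H, forall h, f (hset_act X x h) = hset_act Y (f x) h}) ->
  hset_iso X Y.
Proof.
move=> injf surjf fact; exists f => //.
have surjfb y : exists x, f x == y by have [x <-] := surjf y; exists x.
pose finv y := xchoose (surjfb y).
have finvK : cancel finv f by move=> y; apply/eqP/(xchooseP (surjfb y)).
by exists finv => // x; apply: injf; rewrite finvK.
Qed.

Lemma hset_iso_sym H (X Y : hset H) : hset_iso X Y -> hset_iso Y X.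
Proof.
case=> f [g fK gK] fact; exists g; first by exists f.
by move=> y h Hh; rewrite -{1}(gK y) -fact // fK.
Qed.

Lemma hset_iso_trans H (X Y Z : hset H) :
  hset_iso X Y -> hset_iso Y Z -> hset_iso X Z.
Proof.
case=> f bijf fact [f' bijf' fact']; exists (f' \o f); first exact: bij_comp.
by move=> x h Hh /=; rewrite fact // fact'.
Qed.

Lemma hset_stab_equivariant H (X Y : hset H) (f : X -> Y) (x : X) :
    injective f ->
    (forall u, {in H, forall h, f (hset_act X u h) = hset_act Y (f u) h}) ->
  hset_stab (f x) = hset_stab x.
Proof.
move=> injf fact; apply: group_ext => h; rewrite !mem_hset_stab.
by case Hh: (h \in H) => //=; rewrite -fact // inj_eq.
Qed.

Lemma val_hset_sub H (X : hset H) (S : {set X})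
    (nS : [acts H, on S | hset_act X]) (u : hset_sub nS) h :
  h \in H -> val (hset_act (hset_sub nS) u h) = hset_act X (val u) h.
Proof.
move=> Hh; rewrite /hset_sub /= /ract /=.
by rewrite val_subact (subsetP (sub_act_dom nS) h Hh).
Qed.

Lemma hset_stab_hset_sub H (X : hset H) (S : {set X})
    (nS : [acts H, on S | hset_act X]) (u : hset_sub nS) :
  hset_stab u = hset_stab (val u).
Proof.
symmetry; apply: (@hset_stab_equivariant H (hset_sub nS) X val u val_inj).
by move=> v h Hh; apply: val_hset_sub.
Qed.

Lemma val_hset_coset H K (C : hset_coset H K) h :
  h \in H -> val (hset_act (hset_coset H K) C h) = val C :* h.
Proof. by move=> Hh; rewrite val_hset_sub // -rcosetE. Qed.

Lemma hset_cosetP H K (C : hset_coset H K) :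
  exists2 h, h \in H & val C = K :* h.
Proof. by apply/rcosetsP; apply: (valP C). Qed.

Lemma hset_stab_coset H K (C : hset_coset H K) h :
  K \subset H -> h \in H -> val C = K :* h -> hset_stab C = (K :^ h)%G.
Proof.
move=> sKH Hh defC; apply: group_ext => a; rewrite mem_hset_stab.
case Ha: (a \in H) => /=.
  rewrite -(inj_eq val_inj) val_hset_coset // defC -rcosetM.
  rewrite -[LHS](sameP rcoset_eqP eqP) mem_rcoset mem_conjg conjgE invgK.
  by rewrite mulgA.
by apply/esym/negP=> /(subsetP (conj_subG Hh sKH)); rewrite Ha.
Qed.

Lemma group_in_rcosets H K : (K : {set gT}) \in rcosets K H.
Proof. by apply/rcosetsP; exists 1; rewrite ?group1 ?rcoset1. Qed.

Definition base_coset H K : hset_coset H K :=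
  Sub (K : {set gT}) (group_in_rcosets H K).

Lemma hset_stab_base_coset H K : K \subset H -> hset_stab (base_coset H K) = K.
Proof.
move=> sKH; rewrite (@hset_stab_coset _ _ _ 1) ?group1 ?rcoset1 //.
by apply/val_inj; rewrite /= conjsg1.
Qed.

(** * Stabilizers under the operations on H-sets *)

Lemma hset_stab_trivial H (X : hset H) (x : X) :
  hset_trivial X -> hset_stab x = H.
Proof.
move=> trivX; apply: group_ext => h; rewrite mem_hset_stab.
by case Hh: (h \in H) => //=; rewrite trivX ?eqxx.
Qed.

Lemma hset_stab_res H K (sKH : K \subset H) (X : hset H) (x : X) :
  @hset_stab K (hset_res sKH X) x = (hset_stab x :&: K)%G.
Proof.
apply: group_ext => h; rewrite mem_hset_stab in_setI mem_hset_stab /=.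
by rewrite andbC; case Kh: (h \in K); rewrite ?andbF // (subsetP sKH) ?andbT.
Qed.

Lemma hset_stab_conj H g (X : hset H) (x : X) :
  @hset_stab (H :^ g^-1)%G (hset_conj g X) x = (hset_stab x :^ g^-1)%G.
Proof.
by apply: group_ext => h; rewrite mem_hset_stab !mem_conjgV mem_hset_stab.
Qed.

Lemma hset_stab_inl H (X Y : hset H) (x : X) :
  @hset_stab H (hset_sum X Y) (inl x) = hset_stab x.
Proof. by apply: (@hset_stab_equivariant H X (hset_sum X Y) inl) => // ? ? []. Qed.

Lemma hset_stab_inr H (X Y : hset H) (y : Y) :
  @hset_stab H (hset_sum X Y) (inr y) = hset_stab y.
Proof. by apply: (@hset_stab_equivariant H Y (hset_sum X Y) inr) => // ? ? []. Qed.

Lemma hset_stab_coprod H n (F : 'I_n -> hset H) i (x : F i) :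
  @hset_stab H (hset_coprod F) (Tagged F x) = hset_stab x.
Proof.
apply: (@hset_stab_equivariant H (F i) (hset_coprod F) (fun x => Tagged F x)).
  by move=> y z /eqP; rewrite eq_Tagged => /eqP.
by [].
Qed.

Lemma bal_class_shift K (X : hset K) (x : X) k a :
  k \in K -> bal_class (hset_act X x k) a = bal_class x (k * a).
Proof.
move=> Kk; apply/setP=> z; apply/imsetP/imsetP=> -[j Kj ->].
  by exists (k * j); rewrite ?groupM // actMin // invMg -mulgA mulKg.
exists (k^-1 * j); rewrite ?groupM ?groupV //.
by rewrite -actMin ?groupM ?groupV // mulKVg invMg invgK mulgA.
Qed.

Lemma bal_class_act H K (X : hset K) (x : X) a h :
  hset_act (bal_hset H X) (bal_class x a) h = bal_class x (a * h).
Proof.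
rewrite /= /setact /bal_class -imset_comp; apply: eq_imset => k /=.
by rewrite /bal_act /= mulgA.
Qed.

Lemma val_hset_ind H K (X : hset K) (u : hset_ind H X) h :
  h \in H ->
  val (hset_act (hset_ind H X) u h) = hset_act (bal_hset H X) (val u) h.
Proof. exact: val_hset_sub. Qed.

(** The class of (x, a) is the translate by [a] of the class of (x, 1).  The
    stabilizer of the latter is that of [x]: if (x, h) is balanced-equivalent
    to (x, 1), then h lies in K and fixes [x]. *)
Lemma hset_stab_ind H K (X : hset K) (u : hset_ind H X) (x : X) a :
    K \subset H -> a \in H -> val u = bal_class x a ->
  hset_stab u = (hset_stab x :^ a)%G.
Proof.
move=> sKH Ha defu; apply: group_ext => h; rewrite mem_hset_stab.
case Hh: (h \in H) => /=; last first.
  have sSaH := conj_subG Ha (subset_trans (hset_stab_sub x) sKH).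
  by apply/esym/negP=> /(subsetP sSaH); rewrite Hh.
rewrite -(inj_eq val_inj) val_hset_ind // defu bal_class_act mem_conjg.
have -> : h ^ a^-1 = a * h * a^-1 by rewrite conjgE invgK mulgA.
apply/eqP/idP=> [eq_ah | ].
  have: (x, a * h) \in bal_class x (a * h).
    by apply/imsetP; exists 1; rewrite ?group1 // act1 invg1 mul1g.
  rewrite eq_ah => /imsetP[k Kk [xk ->]].
  (* Now a * h * a^-1 is k^-1, with k in K fixing x. *)
  by rewrite mulgK groupV mem_hset_stab Kk -xk /=.
rewrite mem_hset_stab => /andP[Kk /eqP xk].
by rewrite -{2}xk bal_class_shift // mulgKV.
Qed.

Lemma hset_indP H K (X : hset K) (u : hset_ind H X) :
  exists x : X, exists2 a, a \in H & val u = bal_class x a.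
Proof.
have /imset2P[x a _ Ha def_u] := valP u.
by exists x; exists a.
Qed.

Lemma bal_class_in H K (X : hset K) (x : X) : bal_class x 1 \in bal_classes H X.
Proof. by apply/imset2P; exists x 1; rewrite ?inE ?group1. Qed.

(** * Orbit decomposition *)

(** The equivariant embedding of H/Stab(x) onto the orbit of [x].  Any element
    of the coset can stand for [repr (val C)], by [orbit_mapE]. *)
Definition orbit_map H (X : hset H) (x : X)
    (C : hset_coset H (hset_stab x)) : X :=
  hset_act X x (repr (val C)).

Section OrbitMap.
Variables (H : {group gT}) (X : hset H).
Implicit Types x y : X.

Lemma orbit_mapE x (C : hset_coset H (hset_stab x)) h :
  h \in H -> val C = hset_stab x :* h -> orbit_map C = hset_act X x h.
Proof.
move=> Hh defC; rewrite /orbit_map defC.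
have /rcosetP[k] := mem_repr_rcoset (hset_stab x) h.
by rewrite mem_hset_stab => /andP[Hk /eqP xk] ->; rewrite actMin // xk.
Qed.

Lemma orbit_map_inj x : injective (@orbit_map H X x).
Proof.
move=> C D; have [h Hh defC] := hset_cosetP C; have [k Hk defD] := hset_cosetP D.
rewrite (orbit_mapE Hh defC) (orbit_mapE Hk defD) => eq_hk; apply: val_inj.
rewrite defC defD; apply/rcoset_eqP; rewrite mem_rcoset mem_hset_stab.
by rewrite groupM ?groupV // actMin ?groupV // eq_hk -actMin ?groupV // mulgV act1 /=.
Qed.

Lemma orbit_map_equivariant x (C : hset_coset H (hset_stab x)) :
  {in H, forall h, orbit_map (hset_act (hset_coset H (hset_stab x)) C h)
                   = hset_act X (orbit_map C) h}.
Proof.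
move=> h Hh; have [k Hk defC] := hset_cosetP C.
rewrite (orbit_mapE Hk defC) -actMin //; apply: orbit_mapE; first exact: groupM.
by rewrite val_hset_coset // defC rcosetM.
Qed.

Lemma orbit_map_surj x y :
  y \in orbit (hset_act X) H x -> exists C, @orbit_map H X x C = y.
Proof.
case/orbitP=> h Hh <-.
have coset_h : hset_stab x :* h \in rcosets (hset_stab x) H.
  by apply/rcosetsP; exists h.
pose C : hset_coset H (hset_stab x) := Sub (hset_stab x :* h) coset_h.
by exists C; apply: orbit_mapE.
Qed.

Lemma orbit_map_in x C : @orbit_map H X x C \in orbit (hset_act X) H x.
Proof.
have [h Hh defC] := hset_cosetP C.
by rewrite (orbit_mapE Hh defC); apply: mem_orbit.
Qed.

(** With one base point r(i) chosen in each orbit, the orbit maps at the r(i)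
    cover X; two of them meet only when their base points lie in the same
    orbit, and then they are the same map. *)
Lemma hset_orbit_decomposition :
  exists (n : nat) (r : 'I_n -> X),
    hset_iso X (hset_coprod (fun i => hset_coset H (hset_stab (r i)))).
Proof.
have acts_all : [acts H, on [set: X] | hset_act X].
  apply/subsetP=> h Hh; rewrite !inE Hh /=.
  by apply/subsetP=> x _; rewrite !inE.
have [_ _ inT] := orbit_transversalP acts_all.
set T := orbit_transversal _ _ _ in inT * => hitT.
pose r (i : 'I_#|T|) : X := enum_val i.
pose F i := hset_coset H (hset_stab (r i)).
exists #|T|, r; apply: hset_iso_sym.
pose f (u : hset_coprod F) := orbit_map (tagged u).
apply: (@hset_iso_surj H (hset_coprod F) X f).
- move=> [i C] [j D]; rewrite /f /= => eqCD.
  have eq_ij : i = j.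
    apply: enum_val_inj; apply/eqP; rewrite -inT ?enum_valP //.
    rewrite -(orbit_in_transl _ _ (orbit_map_in D)) //.
    by rewrite -eqCD orbit_map_in.
  by case: j / eq_ij D eqCD => D /orbit_map_inj->.
- move=> y; have [h Hh Tyh] := hitT y (in_setT y).
  have [|C defC] := @orbit_map_surj (r (enum_rank_in Tyh (hset_act X y h))) y.
    by rewrite /r enum_rankK_in // orbit_in_sym // mem_orbit.
  by exists (Tagged F C).
- by move=> [i C] h Hh; apply: orbit_map_equivariant.
Qed.

End OrbitMap.

End Stabilizers.

(** * From transfer systems to indexing systems *)

Section IndexingOfTransfer.
Variables (gT : finGroupType) (R : sub_relation gT).
Hypothesis trR : transfer_system R.
Implicit Types (H K L : {group gT}) (h : gT).

(** Invariance of R under all of G makes it invariant under H in the first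
    argument alone, as H normalizes itself. *)
Lemma transfer_conj_in K H h : R K H -> h \in H -> R (K :^ h)%G H.
Proof.
move=> RKH Hh; have := tr_conj trR h^-1 RKH.
have -> : (H :^ h^-1^-1)%G = H by apply: val_inj; rewrite /= invgK conjGid.
by have -> : (K :^ h^-1^-1)%G = (K :^ h)%G by apply: val_inj; rewrite /= invgK.
Qed.

(** A decomposition of X into orbits H/K(i) exhibits each stabilizer of X as an
    H-conjugate of some K(i); conversely X always decomposes into the quotients
    of H by stabilizers of its own points. *)
Lemma indexing_ofP H (X : hset H) :
  indexing_of R X <-> forall x : X, R (hset_stab x) H.
Proof.
split=> [[n [K [RKH [f bijf fact]]]] x | RXH].
  rewrite -(hset_stab_equivariant x (bij_inj bijf) fact).
  case: (f x) => i C; rewrite (hset_stab_coprod C).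
  have [h Hh defC] := hset_cosetP C; have [sKH RKiH] := RKH i.
  by rewrite (hset_stab_coset sKH Hh defC); apply: transfer_conj_in.
have [n [r isoX]] := hset_orbit_decomposition X.
exists n, (fun i => hset_stab (r i)); split=> // i.
by split; [apply: hset_stab_sub | apply: RXH].
Qed.

Lemma indexing_of_system : indexing_system (indexing_of R).
Proof.
split.
- move=> H X trivX; apply/indexing_ofP=> x.
  by rewrite hset_stab_trivial //; apply: (tr_refl trR).
- move=> H X Y isoXY [n [K [RKH isoX]]]; exists n, K; split=> //.
  exact: hset_iso_trans (hset_iso_sym isoXY) isoX.
- move=> H K sKH X /indexing_ofP RX; apply/indexing_ofP=> x.
  by rewrite hset_stab_res; apply: (tr_res trR).
- move=> H g X /indexing_ofP RX; apply/indexing_ofP=> x.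
  by rewrite hset_stab_conj; apply: (tr_conj trR).
- move=> H X S nS /indexing_ofP RX; apply/indexing_ofP=> u.
  by rewrite hset_stab_hset_sub.
- move=> H X Y /indexing_ofP RX /indexing_ofP RY; apply/indexing_ofP.
  by case=> [x | y]; rewrite ?hset_stab_inl ?hset_stab_inr.
- move=> H K X sKH /indexing_ofP RX /indexing_ofP RHK; apply/indexing_ofP=> u.
  have [x [a Ha def_u]] := hset_indP u.
  rewrite (hset_stab_ind sKH Ha def_u); apply: transfer_conj_in Ha.
  apply: (tr_trans trR) (RX x) _.
  by have := RHK (base_coset H K); rewrite hset_stab_base_coset.
Qed.

Lemma indexing_of_cosetP H K :
  K \subset H -> indexing_of R (hset_coset H K) <-> R K H.
Proof.
move=> sKH; split=> [/indexing_ofP RHK | RKH].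
  by have := RHK (base_coset H K); rewrite hset_stab_base_coset.
apply/indexing_ofP=> C; have [h Hh defC] := hset_cosetP C.
by rewrite (hset_stab_coset sKH Hh defC); apply: transfer_conj_in.
Qed.

Lemma graph_indexing_of H K : graph (indexing_of R) K H <-> R K H.
Proof.
split=> [[sKH /indexing_of_cosetP] | RKH]; first exact.
have sKH := tr_sub trR RKH.
by split=> //; apply/indexing_of_cosetP.
Qed.

End IndexingOfTransfer.

(** * From indexing systems to transfer systems *)

Section GraphOfIndexing.
Variables (gT : finGroupType) (I : hset_family gT).
Hypothesis idxI : indexing_system I.
Implicit Types (H K L : {group gT}) (h : gT).

(** The axiom on sub-H-sets speaks of subtypes of a member; invariance under
    isomorphism extends it to every H-set that embeds in a member. *)
Lemma idx_embed H (X Y : hset H) (f : X -> Y) :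
    injective f ->
    (forall x, {in H, forall h, f (hset_act X x h) = hset_act Y (f x) h}) ->
  I Y -> I X.
Proof.
move=> injf fact IY.
have nS : [acts H, on f @: [set: X] | hset_act Y].
  apply/subsetP=> h Hh; rewrite !inE Hh /=.
  apply/subsetP=> _ /imsetP[x _ ->]; rewrite inE -fact //.
  exact: imset_f.
apply: (idx_iso idxI) (idx_sub idxI nS IY); apply: hset_iso_sym.
pose f' (x : X) : hset_sub nS := Sub (f x) (imset_f f (in_setT x)).
apply: (hset_iso_surj (f := f')).
- by move=> x y /(congr1 val) /injf.
- move=> u; have /imsetP[x _ def_u] := valP u.
  by exists x; apply: val_inj.
- by move=> x h Hh; apply: val_inj; rewrite val_hset_sub //= fact.
Qed.

(** The source of all closure properties of the graph: H/Stab(x) embeds in X as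
    the orbit of [x]. *)
Lemma graph_hset_stab H (X : hset H) (x : X) : I X -> graph I (hset_stab x) H.
Proof.
move=> IX; split; first exact: hset_stab_sub.
apply: idx_embed IX; first exact: (@orbit_map_inj _ H X x).
exact: orbit_map_equivariant.
Qed.

Lemma graph_transfer : transfer_system (graph I).
Proof.
split.
- move=> H; split=> //; apply: (idx_trivial idxI) => C h Hh.
  apply: val_inj; rewrite val_hset_coset //.
  have [a Ha ->] := hset_cosetP C.
  by rewrite -rcosetM !rcoset_id ?groupM.
- move=> K H [sKH _] [sHK _]; apply/val_inj/eqP.
  by rewrite eqEsubset sKH.
- move=> L K H [sLK ILK] [sKH IKH].
  (* L is the stabilizer of the class of (L, 1) in the set induced from K/L. *)
  pose X := hset_coset K L.
  pose u : hset_ind H X :=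
    Sub (bal_class (base_coset K L) 1) (bal_class_in H (base_coset K L)).
  have := graph_hset_stab u (idx_ind idxI sKH ILK IKH).
  rewrite (hset_stab_ind (x := base_coset K L) (a := 1)) //.
  rewrite hset_stab_base_coset //.
  by have -> : (L :^ 1)%G = L by apply: val_inj; rewrite /= conjsg1.
- by move=> K H [].
- move=> K H g [sKH IKH].
  (* The base coset of H/K has the conjugate of K as stabilizer once H/K is
     viewed as a set over the conjugate of H. *)
  have := @graph_hset_stab (H :^ g^-1)%G (hset_conj g _) (base_coset H K) (idx_conj idxI g IKH).
  by rewrite hset_stab_conj hset_stab_base_coset.
- move=> K H L [sKH IKH] sLH.
  (* In H/K restricted to L, the base coset has stabilizer K :&: L. *)
  have := @graph_hset_stab L (hset_res sLH _) (base_coset H K) (idx_res idxI sLH IKH).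
  by rewrite hset_stab_res hset_stab_base_coset.
Qed.

Lemma idx_coprod H n (F : 'I_n -> hset H) :
  (forall i, I (F i)) -> I (hset_coprod F).
Proof.
elim: n F => [|n IHn] F IF.
  by apply: (idx_trivial idxI) => -[[]].
have IX := idx_sum idxI (IF ord0) (IHn (fun i => F (lift ord0 i)) (fun i => IF _)).
apply: (idx_iso idxI) IX.
set X := hset_sum _ _.
pose f (u : X) : hset_coprod F :=
  match u with
  | inl x => Tagged F x
  | inr v => Tagged F (tagged v)
  end.
apply: (hset_iso_surj (f := f)).
- move=> [x | [i x]] [y | [j y]] //= eq_xy.
  + by move/eqP: eq_xy; rewrite eq_Tagged => /eqP /= ->.
  + have /= /lift_inj eq_ij := congr1 tag eq_xy.
    case: j / eq_ij y eq_xy => y /eqP.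
    by rewrite eq_Tagged => /eqP /= ->.
- move=> [i x]; case: (unliftP ord0 i) x => [j|] -> x.
    by exists (inr (Tagged (fun i => F (lift ord0 i)) x)).
  by exists (inl x).
- by move=> [x | [i x]].
Qed.

Lemma indexing_system_stabP H (X : hset H) :
  I X <-> forall x : X, graph I (hset_stab x) H.
Proof.
split=> [IX x | IstabX]; first exact: graph_hset_stab.
have [n [r isoX]] := hset_orbit_decomposition X.
apply: (idx_iso idxI) (hset_iso_sym isoX) _.
by apply: idx_coprod => i; have [] := IstabX (r i).
Qed.

Lemma indexing_of_graph H (X : hset H) : indexing_of (graph I) X <-> I X.
Proof.
apply: iff_trans (iff_sym (indexing_system_stabP X)).
exact: (indexing_ofP graph_transfer).
Qed.

End GraphOfIndexing.

(** * The correspondence *)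

Section Correspondence.
Variable gT : finGroupType.
Implicit Types (I J : hset_family gT) (R : sub_relation gT).

Lemma graphK I : indexing_system I -> indexing_of (graph I) = I.
Proof.
move=> idxI; apply: functional_extensionality_dep => H.
apply: functional_extensionality => X; apply: propositional_extensionality.
exact: indexing_of_graph.
Qed.

Lemma indexing_ofK R : transfer_system R -> graph (indexing_of R) = R.
Proof.
move=> trR; apply: functional_extensionality => K.
apply: functional_extensionality => H; apply: propositional_extensionality.
exact: graph_indexing_of.
Qed.

Lemma graph_le I J : indexing_le I J -> transfer_le (graph I) (graph J).
Proof. by move=> leIJ K H [sKH IHK]; split=> //; apply: leIJ. Qed.

Lemma indexing_of_le (R1 R2 : sub_relation gT) :
  transfer_le R1 R2 -> indexing_le (indexing_of R1) (indexing_of R2).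
Proof.
move=> leR H X [n [K [RKH isoX]]]; exists n, K; split=> // i.
by have [sKH /leR] := RKH i.
Qed.

Lemma graph_saturated I :
  Lambda_indexing_system I -> saturated_transfer_system (graph I).
Proof.
case=> idxI LambdaI; split; first exact: graph_transfer.
move=> K L H [_ IHK] sKL sLH; have [ILK IHL] := LambdaI K L H sKL sLH IHK.
by split; split.
Qed.

Lemma indexing_of_Lambda R :
  saturated_transfer_system R -> Lambda_indexing_system (indexing_of R).
Proof.
case=> trR satR; split; first exact: indexing_of_system.
move=> K L H sKL sLH.
move/(indexing_of_cosetP trR (subset_trans sKL sLH)) => RKH.
have [RKL RLH] := satR K L H RKH sKL sLH.
by split; apply/(indexing_of_cosetP trR).
Qed.

End Correspondence.

Theorem theorem3p7 (gT : finGroupType) :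
  inverse_order_isos
    (@indexing_system gT) (@indexing_le gT)
    (@transfer_system gT) (@transfer_le gT)
    (@graph gT) (@indexing_of gT)
  /\
  inverse_order_isos
    (@Lambda_indexing_system gT) (@indexing_le gT)
    (@saturated_transfer_system gT) (@transfer_le gT)
    (@graph gT) (@indexing_of gT).
Proof.
split; split.
- exact: graph_transfer.
- exact: indexing_of_system.
- exact: graphK.
- exact: indexing_ofK.
- by move=> I J _ _; apply: graph_le.
- by move=> R1 R2 _ _; apply: indexing_of_le.
- exact: graph_saturated.
- exact: indexing_of_Lambda.
- by move=> I [idxI _]; apply: graphK.
- by move=> R [trR _]; apply: indexing_ofK.
- by move=> I J _ _; apply: graph_le.
- by move=> R1 R2 _ _; apply: indexing_of_le.
Qed.
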